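(* Let $1 \leqslant p < 2$ and let $\{X_{n}, \, n \geqslant 1 \}$ be a sequence of identically distributed pairwise positively quadrant dependent random variables. Suppose that $\frac{1}{n^{1/p}}\sum_{k=1}^{n} (X_{k} - c) \to 0$ almost surely for some finite constant $c$, and that \[ \sum_{1 \leqslant k < j < \infty} (kj)^{-1/p}\, G_{X_{k},X_{j}} \big(k^{1/p},j^{1/p} \big) < \infty . \] Then $\sum_{k=1}^{\infty} \mathbb{P} \left\{\lvert X_{1} \rvert > k^{1/p} \right\} < \infty$.
   Context: A sequence $\{X_{n}, \, n \geqslant 1 \}$ of random variables is pairwise positively quadrant dependent (pairwise PQD) if $\mathbb{P}\{X_{k} \leqslant x_{k}, X_{j} \leqslant x_{j}\} - \mathbb{P}\{X_{k} \leqslant x_{k}\}\mathbb{P}\{X_{j} \leqslant x_{j}\} \geqslant 0$ for all reals $x_{k}, x_{j}$ and all positive integers $k \neq j$. For random variables $X_k, X_j$ and $u,v>0$, \[ G_{X_{k},X_{j}}(u,v) := \int_{-v}^{v} \int_{-u}^{u} \big[\mathbb{P} \{X_{k} > x, X_{j} > y \} - \mathbb{P} \{X_{k} > x \} \mathbb{P} \{X_{j} > y \}\big] \, \mathrm{d}x \, \mathrm{d}y . \] *)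

(* Defs.v *)
From HB Require Import structures.
From mathcomp Require Import all_boot all_order all_algebra.
From mathcomp Require Import all_classical all_reals all_analysis.
Set Implicit Arguments. Unset Strict Implicit. Unset Printing Implicit Defensive.
Import Order.TTheory GRing.Theory Num.Theory.
Local Open Scope classical_set_scope.
Local Open Scope ring_scope.

Definition pairwise_PQD d (T : measurableType d) (R : realType)
  (P : probability T R) (X : nat -> T -> R) : Prop :=
  forall (k j : nat), (1 <= k)%N -> (1 <= j)%N -> k <> j ->
  forall x y : R,
    (P [set w | (X k w <= x)%R] * P [set w | (X j w <= y)%R]
       <= P [set w | (X k w <= x)%R /\ (X j w <= y)%R])%E.

Definition identically_distributed d (T : measurableType d) (R : realType)
  (P : probability T R) (X : nat -> {RV P >-> R}) : Prop :=
  forall k j : nat, (1 <= k)%N -> (1 <= j)%N ->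
  forall A : set R, measurable A ->
    distribution P (X k) A = distribution P (X j) A.

Definition Hcov d (T : measurableType d) (R : realType)
  (P : probability T R) (U V : T -> R) (x y : R) : R :=
  fine (P [set w | x < U w /\ y < V w])
  - fine (P [set w | x < U w]) * fine (P [set w | y < V w]).

Definition Gfun d (T : measurableType d) (R : realType)
  (P : probability T R) (U V : T -> R) (u v : R) : \bar R :=
  (\int[lebesgue_measure]_(y in `[(- v)%R, v])
     \int[lebesgue_measure]_(x in `[(- u)%R, u]) (Hcov P U V x y)%:E)%E.

(* Main.v *)
(** Truncate [X k] softly at height [k^(1/p)]: let [Y k] be the ramp of [X k] rising
    from 0 at [k^(1/p)/2] to 1 at [k^(1/p)].  By Hoeffding's identity the covariance of
    two such ramps is the integral of [Hcov] over a rectangle, divided by its area;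
    since [Hcov >= 0] under PQD, it is at most [4 (kj)^(-1/p)] times [Gfun].  Hence the
    variance of the partial sums of [Y] exceeds their mean by a bounded amount at most.
    On the other hand the strong law forces [X n / n^(1/p) -> 0], so almost surely
    [Y n = 0] eventually and the partial sums stay bounded; by Chebyshev's inequality
    their means must then be bounded too, and these dominate the sums of
    [P (X k > k^(1/p))].  The lower tail is symmetric. *)
Require Import Defs.
From HB Require Import structures.
From mathcomp Require Import all_boot all_order all_algebra.
From mathcomp Require Import all_classical all_reals all_analysis.
From mathcomp Require Import measurable_realfun ring lra.
Import Order.TTheory GRing.Theory Num.Theory.
Local Open Scope classical_set_scope.
Local Open Scope ring_scope.

(** * Ramps on the real line as integrals of indicators *)

Section ramp.
Local Open Scope ereal_scope.
Context {R : realType}.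

(** For [s <= t] this is the length of the part of [[s, t]] below [x]. Leaving it unnormalised makes
    its moments plain integrals of tail probabilities. *)
Definition ramp (s t x : R) : R := (Num.min (Num.max (x - s) 0) (t - s))%R.

Lemma ramp_ge0 (s t x : R) : (s <= t -> 0 <= ramp s t x)%R.
Proof. by move=> st; rewrite le_min le_max lexx orbT subr_ge0. Qed.

Lemma ramp_le (s t x : R) : (ramp s t x <= t - s)%R.
Proof. by rewrite ge_min lexx orbT. Qed.

Lemma ramp_low (s t x : R) : (s <= t -> x <= s -> ramp s t x = 0)%R.
Proof.
move=> st xs; rewrite /ramp max_r ?subr_le0// min_l// subr_ge0//.
Qed.

Lemma ramp_high (s t x : R) : (t <= x -> ramp s t x = t - s)%R.
Proof. by move=> tx; rewrite /ramp min_r// le_max lerD2r tx. Qed.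

Lemma measurable_ramp (s t : R) : measurable_fun setT (ramp s t).
Proof.
apply: measurable_minr => //; apply: measurable_maxr => //.
exact: measurable_funB.
Qed.

Lemma integral_ramp (s t u : R) : (s <= t)%R ->
  \int[lebesgue_measure]_(x in `[s, t]) (\1_`]-oo, u[ x)%:E = (ramp s t u)%:E.
Proof.
move=> st; rewrite integral_indic//=.
have [us|su] := leP u s.
  rewrite ramp_low// (_ : _ `&` _ = set0) ?measure0// -subset0 => x /= [].
  by rewrite !in_itv/= => xu /andP[sx _]; move: (le_lt_trans sx xu); rewrite ltNge us.
have [tu|ut] := ltP t u.
  rewrite ramp_high ?ltW// setIidr; last first.
    move=> x /=; rewrite !in_itv/= => /andP[_ xt]; exact: le_lt_trans tu.
  rewrite lebesgue_measure_itv/= lte_fin; case: ltP => // ts.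
  have -> : s = t by apply/eqP; rewrite eq_le st ts.
  by rewrite subrr.
rewrite (_ : _ `&` _ = `[s, u[%classic); last first.
  apply/seteqP; split=> x /=; rewrite !in_itv/=.
    by move=> [-> /andP[-> _]].
  by move=> /andP[-> xu]; rewrite xu (le_trans (ltW xu) ut).
rewrite lebesgue_measure_itv/= lte_fin su /ramp max_l ?subr_ge0 ?ltW//.
by rewrite min_l// lerD2r.
Qed.

Definition nramp (s t x : R) : R := (ramp s t x / (t - s))%R.

Lemma nramp01 (s t x : R) : (s <= t -> 0 <= nramp s t x <= 1)%R.
Proof.
(* For [s = t] the inverse of 0 is 0, so [nramp] vanishes. This degenerate ramp does occur: the
   threshold at index 0 is 0. *)
rewrite le_eqVlt => /predU1P[->|st]; first by rewrite /nramp subrr invr0 mulr0 lexx ler01.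
by rewrite divr_ge0 ?ramp_ge0 ?subr_ge0 ?(ltW st)//= ler_pdivrMr ?subr_gt0// mul1r ramp_le.
Qed.

Lemma nramp0 (s t x : R) : (s <= t -> x <= s -> nramp s t x = 0)%R.
Proof. by move=> st xs; rewrite /nramp ramp_low// mul0r. Qed.

Lemma nramp1 (s t x : R) : (s < t -> t <= x -> nramp s t x = 1)%R.
Proof. by move=> st xs; rewrite /nramp ramp_high// mulfV// gt_eqF// subr_gt0. Qed.

Lemma measurable_nramp (s t : R) : measurable_fun setT (nramp s t).
Proof. by apply: measurable_funM => //; exact: measurable_ramp. Qed.

End ramp.

(** * Integrability, tail integrals and positive dependence *)

Section probability.
Local Open Scope ereal_scope.
Context {R : realType} {d : measure_display} {T : measurableType d}.
Variable P : probability T R.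
Local Notation mu := (@lebesgue_measure R).

Lemma bounded_Lfun (f : T -> R) (M r : R) : (1 <= r)%R ->
  measurable_fun setT f -> (forall w, `|f w| <= M)%R -> f \in Lfun P r%:E.
Proof.
move=> r1 mf fM; rewrite inE; apply/andP; split; first by rewrite inE.
rewrite inE/= /finite_norm unlock poweR_lty//.
rewrite (@le_lt_trans _ _ (\int[P]_x (M `^ r)%:E))//; last first.
  by rewrite integral_cst//= probability_setT mule1 ltry.
apply: ge0_le_integral => //.
- by move=> x _; exact: poweR_ge0.
- rewrite (_ : (fun _ => _) = EFin \o (fun x => `|f x| `^ r)%R)//.
  apply/measurable_EFinP/(measurableT_comp (measurable_powR _)).
  exact: measurableT_comp.
- move=> x _; rewrite lee_fin ge0_ler_powR ?nnegrE ?(le_trans ler01 r1)//.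
  exact: le_trans (normr_ge0 _) (fM x).
Qed.

Lemma bounded01_Lfun2 (Y : T -> R) : measurable_fun setT Y ->
  (forall w, 0 <= Y w <= 1)%R -> Y \in Lfun P 2%:E.
Proof.
move=> mY Y01; apply: (bounded_Lfun _ 1); rewrite ?ler1n// => w.
by have /andP[? ?] := Y01 w; rewrite ger0_norm.
Qed.

Lemma ramp_Lfun2 (W : T -> R) (s t : R) : measurable_fun setT W ->
  (s <= t)%R -> ramp s t \o W \in Lfun P 2%:E.
Proof.
move=> mW st; apply: (bounded_Lfun _ (t - s)); first by rewrite ler1n.
  by apply: measurableT_comp => //; exact: measurable_ramp.
by move=> w; rewrite ger0_norm ?ramp_ge0//; exact: ramp_le.
Qed.

Lemma Lfun2_Lfun1 (W : T -> R) : W \in Lfun P 2%:E -> W \in Lfun P 1.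
Proof. by apply: Lfun_subset12; exact: fin_num_measure. Qed.

(** Constants have zero covariance with everything and the two signs cancel. This carries the
    covariance bounds for ramps over to their complements, which detect the lower tail. *)
Lemma covariance_onem (X Y : T -> R) : X \in Lfun P 2%:E -> Y \in Lfun P 2%:E ->
  covariance P (cst 1%R \- X)%R (cst 1%R \- Y)%R = covariance P X Y.
Proof.
move=> X2 Y2.
rewrite covarianceBl ?Lfun_cst//; last first.
  by rewrite rpredB ?lee1n// => p1; exact: (Lfun_cst P 1%R 2%R).
by rewrite covariance_cst_l sub0e covarianceBr ?Lfun_cst// covariance_cst_r sub0e oppeK.
Qed.

(** Layer-cake formula: the ramp is the integral over [[s, t]] of the indicator of [x < U w], and
    Tonelli exchanges the two integrals. The weight [g] allows a product of two ramps to be unfolded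
    one factor at a time. *)
Lemma integral_mul_ramp (g : T -> \bar R) (U : T -> R) (s t : R) :
  measurable_fun setT g -> (forall w, 0 <= g w) -> measurable_fun setT U ->
  (s <= t)%R ->
  \int[P]_w (g w * (ramp s t (U w))%:E) =
  \int[mu]_(x in `[s, t]) \int[P]_(w in [set w | (x < U w)%R]) g w.
Proof.
move=> mg g0 mU st.
pose f (z : T * measurableTypeR R) := g z.1 * (\1_[set z | (z.2 < U z.1)%R] z * \1_`[s, t] z.2)%:E.
have mf : measurable_fun setT f.
  apply: emeasurable_funM; first exact: measurableT_comp.
  apply/measurable_EFinP; apply: measurable_funM.
    apply: measurable_indic; rewrite -[X in measurable X]setTI.
    apply: measurable_fun_ltr => //; exact: measurableT_comp.
  by apply: measurableT_comp => //; exact: measurable_indic.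
have f0 z : 0 <= f z.
  by rewrite mule_ge0// lee_fin mulr_ge0.
have fE w x : f (w, x) = g w * ((EFin \o \1_`]-oo, U w[) \_ `[s, t]) x.
  by rewrite epatch_indic /f/= EFinM.
transitivity (\int[P]_w \int[mu]_x f (w, x)).
  apply: eq_integral => w _; rewrite -integral_ramp// [in LHS]integral_mkcond.
  under [in RHS]eq_integral do rewrite fE.
  rewrite ge0_integralZl//.
    apply/(measurable_restrictT _ _).1 => //; apply: measurable_funTS.
    exact: measurableT_comp.
  by move=> x _; rewrite epatch_indic mule_ge0// lee_fin.
rewrite (fubini_tonelli f)// [RHS]integral_mkcond.
apply: eq_integral => x _; rewrite patchE; case: ifPn => xst.
  rewrite [RHS]integral_mkcond; apply: eq_integral => w _.
  by rewrite epatch_indic /f/= (_ : \1_`[s, t] x = 1%R) ?mulr1// indicE xst.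
apply: integral0_eq => w _; rewrite fE patchE (negbTE xst) mule0//.
Qed.

Lemma measurable_gt_set (W : T -> R) (x : R) : measurable_fun setT W ->
  measurable [set w | (x < W w)%R].
Proof.
by move=> mW; rewrite -[X in measurable X]setTI; exact: measurable_fun_ltr.
Qed.

Lemma measurable_tail (W : T -> R) : measurable_fun setT W ->
  measurable_fun setT (fun x : measurableTypeR R => P [set w | (x < W w)%R]).
Proof.
move=> mW.
rewrite (_ : (fun _ => _) = EFin \o (fun x => fine (P [set w | x < W w]%R))).
  apply/measurable_EFinP; apply: nonincreasing_measurable => // x y xy.
  rewrite fine_le ?fin_num_measure//; try exact: measurable_gt_set.
  rewrite le_measure ?inE//; try exact: measurable_gt_set.
  by move=> w /=; exact: le_lt_trans.
by apply/funext => x /=; rewrite fineK// fin_num_measure//; exact: measurable_gt_set.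
Qed.

Lemma expectation_ramp (W : T -> R) (s t : R) : measurable_fun setT W ->
  (s <= t)%R ->
  'E_P[ramp s t \o W] = \int[mu]_(x in `[s, t]) P [set w | (x < W w)%R].
Proof.
move=> mW st; rewrite unlock.
under eq_integral do rewrite -[_%:E]mul1e.
rewrite (integral_mul_ramp (cst 1))//.
apply: eq_integral => x _; rewrite integral_cst ?mul1e//.
exact: measurable_gt_set.
Qed.

(** Quadrant dependence speaks of lower sets and [Hcov] of upper ones. By inclusion-exclusion,
    complementing both events leaves P(A and B) - P(A) P(B) unchanged. *)
Lemma Hcov_ge0 (U V : T -> R) (x y : R) :
  measurable_fun setT U -> measurable_fun setT V ->
  P [set w | (U w <= x)%R] * P [set w | (V w <= y)%R] <=
    P [set w | (U w <= x)%R /\ (V w <= y)%R] ->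
  (0 <= Hcov P U V x y)%R.
Proof.
move=> mU mV.
set A := [set w | (U w <= x)%R]; set B := [set w | (V w <= y)%R].
have mA : measurable A by rewrite -[A]setTI; exact: measurable_fun_ler.
have mB : measurable B by rewrite -[B]setTI; exact: measurable_fun_ler.
rewrite -[[set w | _ /\ _]]/(A `&` B) /Hcov.
have -> : [set w | (x < U w)%R] = ~` A.
  by apply/seteqP; split=> w /=; rewrite ltNge => /negP.
have -> : [set w | (y < V w)%R] = ~` B.
  by apply/seteqP; split=> w /=; rewrite ltNge => /negP.
have -> : [set w | (x < U w)%R /\ (y < V w)%R] = ~` (A `|` B).
  rewrite setCU; apply/seteqP; split=> w /=; rewrite !ltNge.
    by move=> [/negP ? /negP].
  by move=> [? ?]; split; apply/negP.
have mAB := measurableI _ _ mA mB.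
have : P (A `|` B) = P A + P B - P (A `&` B).
  by rewrite measureUfinr// ltey_eq fin_num_measure.
rewrite !probability_setC//; last exact: measurableU.
rewrite -(fineK (fin_num_measure P _ mA)) -(fineK (fin_num_measure P _ mB)).
rewrite -(fineK (fin_num_measure P _ mAB)) => ->.
rewrite -EFinM -EFinD -!EFinB lee_fin /=.
by move=> h; lra.
Qed.

(** * Hoeffding's identity for a pair of ramps *)

Section Hcov.
Variables U V : T -> R.
Hypotheses (mU : measurable_fun setT U) (mV : measurable_fun setT V).

(* The coordinates are swapped to match the order of integration in [Gfun]. *)
Lemma measurable_Hcov :
  measurable_fun setT (fun z : measurableTypeR R * measurableTypeR R =>
    Hcov P U V z.2 z.1).
Proof.
have mP (A : set ((measurableTypeR R * measurableTypeR R) * T)) :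
    measurable A -> measurable_fun setT (fun z => fine (P (xsection A z))).
  move=> mA; apply: measurableT_comp => //; exact: measurable_fun_xsection.
have m1 : measurable [set z : (measurableTypeR R * measurableTypeR R) * T |
     (z.1.2 < U z.2)%R].
  rewrite -[X in measurable X]setTI; apply: measurable_fun_ltr => //;
    by do 2?apply: measurableT_comp => //.
have m2 : measurable [set z : (measurableTypeR R * measurableTypeR R) * T |
     (z.1.1 < V z.2)%R].
  rewrite -[X in measurable X]setTI; apply: measurable_fun_ltr => //;
    by do 2?apply: measurableT_comp => //.
have xsE (Q : (measurableTypeR R * measurableTypeR R) * T -> Prop) z :
  xsection [set z | Q z] z = [set w | Q (z, w)].
  by apply/seteqP; split => w; rewrite /xsection/= inE.
apply: measurable_funB; [|apply: measurable_funM].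
- have := mP _ (measurableI _ _ m1 m2); under eq_fun do rewrite xsE; exact.
- have := mP _ m1; under eq_fun do rewrite xsE; exact.
- have := mP _ m2; under eq_fun do rewrite xsE; exact.
Qed.

Lemma measurable_Hcovl (y : R) :
  measurable_fun setT (fun x : measurableTypeR R => (Hcov P U V x y)%:E).
Proof.
apply/measurable_EFinP.
have := measurableT_comp measurable_Hcov (measurable_fun_pair
  (measurable_cst (y : measurableTypeR R)) (@measurable_id _ (measurableTypeR R) setT)).
exact.
Qed.

(** Two uses of [integral_mul_ramp]: the ramp of [V] is unfolded with the ramp of [U] as weight,
    then, for fixed [y], the ramp of [U] with the indicator of [y < V w] as weight. *)
Lemma expectation_rampM (s t s' t' : R) : (s <= t)%R -> (s' <= t')%R ->
  'E_P[(ramp s t \o U) \* (ramp s' t' \o V)] =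
  \int[mu]_(y in `[s', t']) \int[mu]_(x in `[s, t])
    P [set w | (x < U w)%R /\ (y < V w)%R].
Proof.
move=> st st'; rewrite unlock.
have mrU : measurable_fun setT (fun w => (ramp s t (U w))%:E).
  by apply/measurable_EFinP; apply: measurableT_comp => //; exact: measurable_ramp.
under eq_integral do rewrite EFinM.
rewrite (integral_mul_ramp (EFin \o (ramp s t \o U)))//; last first.
  by move=> w; rewrite lee_fin ramp_ge0.
apply: eq_integral => y _; rewrite integral_mkcond.
under eq_integral do rewrite epatch_indic muleC.
rewrite (integral_mul_ramp (EFin \o \1__))//; last 2 first.
  by apply/measurable_EFinP; apply: measurable_indic; exact: measurable_gt_set.
  by move=> w; rewrite lee_fin.
apply: eq_integral => x _; rewrite integral_indic//; try exact: measurable_gt_set.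
by rewrite setIC.
Qed.

Hypothesis H0 : forall x y, (0 <= Hcov P U V x y)%R.

Lemma measurable_integral_Hcov (s t : R) :
  measurable_fun setT (fun y : measurableTypeR R =>
    \int[mu]_(x in `[s, t]) (Hcov P U V x y)%:E).
Proof.
pose f (z : measurableTypeR R * measurableTypeR R) :=
  (Hcov P U V z.2 z.1 * \1_`[s, t] z.2)%:E.
rewrite (_ : (fun _ => _) = fubini_F mu f).
  apply: measurable_fun_fubini_tonelli_F => [|z]; last first.
    by rewrite lee_fin mulr_ge0.
  apply/measurable_EFinP; apply: measurable_funM; first exact: measurable_Hcov.
  by apply: measurableT_comp => //; exact: measurable_indic.
apply/funext => y; rewrite /fubini_F [LHS]integral_mkcond.
by apply: eq_integral => x _; rewrite epatch_indic /f EFinM.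
Qed.

Lemma covariance_ramp (s t s' t' : R) : (s <= t)%R -> (s' <= t')%R ->
  covariance P (ramp s t \o U) (ramp s' t' \o V) =
  \int[mu]_(y in `[s', t']) \int[mu]_(x in `[s, t]) (Hcov P U V x y)%:E.
Proof.
move=> st st'.
rewrite covarianceE; last 3 first.
- exact/Lfun2_Lfun1/ramp_Lfun2.
- exact/Lfun2_Lfun1/ramp_Lfun2.
- by apply: Lfun2_mul_Lfun1; exact: ramp_Lfun2.
(* Moving the product of the means to the other side leaves only sums of nonnegative integrands,
   thanks to [H0], so integrals add without any integrability check. *)
rewrite [X in X - _](_ : _ =
    \int[mu]_(y in `[s', t']) \int[mu]_(x in `[s, t]) (Hcov P U V x y)%:E +
    'E_P[ramp s t \o U] * 'E_P[ramp s' t' \o V]).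
  by rewrite addeK// fin_numM// expectation_fin_num// Lfun2_Lfun1// ramp_Lfun2.
rewrite -[LHS]/('E_P[(ramp s t \o U) \* (ramp s' t' \o V)]) expectation_rampM//.
rewrite [in RHS](expectation_ramp V)//.
rewrite -ge0_integralZl//; last 2 first.
- by apply: measurable_funTS; exact: measurable_tail.
- by apply: expectation_ge0 => w; rewrite ramp_ge0.
rewrite -ge0_integralD//; last 4 first.
- by move=> y _; apply: integral_ge0 => x _; rewrite lee_fin.
- by apply: measurable_funTS; exact: measurable_integral_Hcov.
- by move=> y _; rewrite mule_ge0// expectation_ge0// => w; rewrite ramp_ge0.
- apply: measurable_funeM; apply: measurable_funTS; exact: measurable_tail.
apply: eq_integral => y _.
rewrite (expectation_ramp U)// -ge0_integralZr//; last first.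
  by apply: measurable_funTS; exact: measurable_tail.
rewrite -ge0_integralD//; last 4 first.
- by move=> x _; rewrite lee_fin.
- by apply: measurable_funTS; exact: measurable_Hcovl.
- by move=> x _; rewrite mule_ge0.
- by apply: emeasurable_funM => //; apply: measurable_funTS; exact: measurable_tail.
apply: eq_integral => x _.
rewrite /Hcov EFinB EFinM !fineK ?fin_num_measure//; try exact: measurable_gt_set.
  rewrite subeK// fin_numM// fin_num_measure//; exact: measurable_gt_set.
by apply: measurableI; exact: measurable_gt_set.
Qed.

(** By [H0] the double integral can only grow when the rectangle is enlarged; the outer interval is
    enlarged first, then the inner one. *)
Lemma covariance_ramp_le (s t s' t' u v : R) : (s <= t)%R -> (s' <= t')%R ->
  (- u <= s)%R -> (t <= u)%R -> (- v <= s')%R -> (t' <= v)%R ->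
  covariance P (ramp s t \o U) (ramp s' t' \o V) <= Gfun P U V u v.
Proof.
move=> st st' us tu vs tv; rewrite covariance_ramp// /Gfun.
apply: (@le_trans _ _ (\int[mu]_(y in `[(- v)%R, v]) \int[mu]_(x in `[s, t])
   (Hcov P U V x y)%:E)).
  apply: ge0_subset_integral => //.
  - by apply: measurable_funTS; exact: measurable_integral_Hcov.
  - by move=> y _; apply: integral_ge0 => x _; rewrite lee_fin.
  - by apply: subset_itv; rewrite bnd_simp.
apply: ge0_le_integral => //.
- by move=> y _; apply: integral_ge0 => x _; rewrite lee_fin.
- by apply: measurable_funTS; exact: measurable_integral_Hcov.
- by apply: measurable_funTS; exact: measurable_integral_Hcov.
move=> y _; apply: ge0_subset_integral => //.
- by apply: measurable_funTS; exact: measurable_Hcovl.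
- by move=> x _; rewrite lee_fin.
- by apply: subset_itv; rewrite bnd_simp.
Qed.

End Hcov.

Lemma covariance_nramp_le (U V : T -> R) (s t s' t' u v : R) :
  measurable_fun setT U -> measurable_fun setT V ->
  (forall x y, 0 <= Hcov P U V x y)%R ->
  (s <= t)%R -> (s' <= t')%R ->
  (- u <= s)%R -> (t <= u)%R -> (- v <= s')%R -> (t' <= v)%R ->
  covariance P (nramp s t \o U) (nramp s' t' \o V) <=
    ((t - s)^-1 * (t' - s')^-1)%:E * Gfun P U V u v.
Proof.
move=> mU mV H0 st st' us tu vs tv.
have LZ (W : T -> R) c : W \in Lfun P 2%:E -> (c \o* W)%R \in Lfun P 2%:E.
  by apply: Lfun_scale; rewrite ler1n.
rewrite -[nramp s t \o U]/((t - s)^-1 \o* (ramp s t \o U))%R.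
rewrite -[nramp s' t' \o V]/((t' - s')^-1 \o* (ramp s' t' \o V))%R.
have [U2 V2] := (ramp_Lfun2 U s t mU st, ramp_Lfun2 V s' t' mV st').
rewrite covarianceZl; last 3 first.
- exact: Lfun2_Lfun1.
- exact/Lfun2_Lfun1/LZ.
- by apply: Lfun2_mul_Lfun1 => //; exact: LZ.
rewrite covarianceZr; last 3 first.
- exact: Lfun2_Lfun1.
- exact: Lfun2_Lfun1.
- exact: Lfun2_mul_Lfun1.
rewrite muleA -EFinM lee_wpmul2l//.
  by rewrite lee_fin mulr_ge0// invr_ge0 subr_ge0.
exact: covariance_ramp_le.
Qed.

(** * Variance of partial sums and the second-moment argument *)

Lemma covariance_sumr (X : T -> R) (Y : nat -> T -> R) (m n : nat) :
  X \in Lfun P 2%:E -> (forall k, Y k \in Lfun P 2%:E) ->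
  covariance P X (\sum_(m <= k < n) Y k)%R =
  \sum_(m <= k < n) covariance P X (Y k).
Proof.
move=> X2 Y2.
elim: n => [|n IH]; first by rewrite !big_geq// covariance_cst_r.
have [mn|nm] := leqP m n; last by rewrite !big_geq// covariance_cst_r.
rewrite !big_nat_recr//= -IH -covarianceDr//.
by rewrite rpred_sum ?lee1n//.
Qed.

Lemma variance_sum (Y : nat -> T -> R) (m n : nat) :
  (forall k, Y k \in Lfun P 2%:E) ->
  'V_P[(\sum_(m <= k < n) Y k)%R] =
  \sum_(m <= k < n) 'V_P[Y k] +
  2%:E * \sum_(m <= k < n) \sum_(k.+1 <= j < n) covariance P (Y k) (Y j).
Proof.
move=> Y2.
have covf k j : covariance P (Y k) (Y j) \is a fin_num.
  by rewrite covariance_fin_num ?Lfun2_mul_Lfun1// Lfun2_Lfun1.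
(* The induction is on the number of terms and peels off the first index [m]: the covariances of
   [Y m] with the remaining sum are then exactly the inner sum over [j > m]. *)
have [l] := ubnP (n - m); elim: l m => // l IH m; rewrite ltnS => nml.
have [mn|nm] := ltnP m n; last first.
  by rewrite !big_geq// mule0 adde0; exact: variance_cst.
rewrite !(big_ltn mn) varianceD//; last first.
  by rewrite rpred_sum ?lee1n//.
rewrite covariance_sumr// IH; last by rewrite subnS -ltnS prednK// subn_gt0.
rewrite muleDr//; last first.
  rewrite fin_num_adde_defr// sum_fin_num//; apply/allP => x /mapP[j _ ->].
  exact: covf.
by rewrite -!addeA; congr (_ + (_ + _)); rewrite addeC.
Qed.

(** On [0, 1] a square is at most its root, so the second moment, and with it the variance, is at
    most the mean. *)
Lemma variance_le_expectation (Y : T -> R) : measurable_fun setT Y ->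
  (forall w, 0 <= Y w <= 1)%R -> 'V_P[Y] <= 'E_P[Y].
Proof.
move=> mY Y01.
have Y2 : Y \in Lfun P 2%:E by exact: bounded01_Lfun2.
rewrite varianceE// (@le_trans _ _ 'E_P[Y ^+ 2])//.
  by rewrite geeDl// oppe_le0 sqre_ge0.
apply: expectation_le => //.
- exact: (measurable_funM mY mY).
- by move=> w; rewrite sqr_ge0.
- by move=> w; have /andP[] := Y01 w.
- apply: aeW => w; have /andP[? ?] := Y01 w.
  by rewrite -[leLHS]/(Y w * Y w)%R ler_piMl.
Qed.

(** Continuity from below trades a random bound for a deterministic one, at the price of an event of
    probability at least 1/2 instead of 1. *)
Lemma bounded_partial_sums_prob (S : nat -> T -> R) :
  (forall n, measurable_fun setT (S n)) ->
  {ae P, forall w, exists M : R, forall n, (S n w <= M)%R} ->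
  exists2 M : R, (0 <= M)%R &
    (2^-1)%:E <= P (\bigcap_n [set w | (S n w <= M)%R]).
Proof.
move=> mS aeS.
pose B (k : nat) := \bigcap_n [set w | (S n w <= k%:R)%R].
have mB k : measurable (B k).
  apply: bigcapT_measurable => n.
  by rewrite -[X in measurable X]setTI; exact: measurable_fun_ler.
have mUB : measurable (\bigcup_k B k) by exact: bigcupT_measurable.
have PUB : P (\bigcup_k B k) = 1.
  (* [A] is a null set containing every point with unbounded [S]; its complement therefore lies in
     the union of the [B k]. *)
  have [A [mA A0 sA]] := aeS.
  apply/eqP; rewrite eq_le probability_le1//=.
  have : 1 <= P A + P (~` A).
    rewrite -(probability_setT P) -(setUv A).
    exact: (measureU2 P mA (measurableC mA)).
  rewrite [P A]A0 add0e => /le_trans; apply.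
  rewrite le_measure ?inE//; first exact: measurableC.
  move=> w Aw; apply: contrapT => Bw; apply: Aw; apply: sA => -[M SM].
  apply: Bw; exists (Num.trunc `|M|).+1 => // n _ /=.
  rewrite (le_trans (SM n))// (le_trans (ler_norm M))// ltW//.
  by rewrite truncnS_gt.
have cB : P \o B @ \oo --> 1%E.
  rewrite -PUB; apply: nondecreasing_cvg_mu => // i j ij.
  apply/subsetPset => w Bw n _ /=.
  by rewrite (le_trans (Bw n _))// ler_nat.
(* If no bound worked, every [P (B k)] would be below 1/2, although these probabilities tend to
   1. *)
apply: contrapT => noM.
suff : 1 <= (2^-1 : R)%:E by rewrite lee_fin; lra.
rewrite -(cvg_lim _ cB)//; apply: lime_le; first by apply/cvg_ex; exists 1.
apply: nearW => k /=; rewrite leNgt; apply/negP => PBk; apply: noM.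
by exists k%:R => //; exact: ltW.
Qed.

Lemma expectation_partial_sums_bounded (Y : nat -> T -> R) (C : R) :
  (forall k, measurable_fun setT (Y k)) ->
  (forall k w, 0 <= Y k w <= 1)%R ->
  (forall n, \sum_(1 <= k < n) \sum_(k.+1 <= j < n) covariance P (Y k) (Y j)
    <= C%:E) ->
  {ae P, forall w, exists M : R, forall n, (\sum_(1 <= k < n) Y k w <= M)%R} ->
  exists M : R, forall n, \sum_(1 <= k < n) 'E_P[Y k] <= M%:E.
Proof.
move=> mY Y01 covC aeY.
have Y2 k : Y k \in Lfun P 2%:E by exact: bounded01_Lfun2.
have Y1 k : Y k \in Lfun P 1 by exact: Lfun2_Lfun1.
pose S n := (\sum_(1 <= k < n) Y k)%R.
have SE n w : S n w = (\sum_(1 <= k < n) Y k w)%R by rewrite /S fct_sumE.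
have mS n : measurable_fun setT (S n).
  rewrite (_ : S n = fun w => \sum_(1 <= k < n) Y k w)%R; last exact/funext/SE.
  exact: measurable_sum.
have [M M0 PM] : exists2 M : R, (0 <= M)%R &
    (2^-1)%:E <= P (\bigcap_n [set w | (S n w <= M)%R]).
  apply: bounded_partial_sums_prob => //.
  by apply: filterS aeY => w [M YM]; exists M => n; rewrite SE.
have ES n : 'E_P[S n] = \sum_(1 <= k < n) 'E_P[Y k].
  elim: n => [|n IH]; first by rewrite /S !big_geq// expectation_cst.
  have [n1|n0] := leqP 1 n; last by rewrite /S !big_geq// expectation_cst.
  rewrite /S !big_nat_recr//= -IH expectationD//.
  by rewrite rpred_sum ?lexx.
have ESfin n : 'E_P[S n] \is a fin_num.
  by rewrite expectation_fin_num// /S rpred_sum ?lexx.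
have VS n : 'V_P[S n] <= 'E_P[S n] + (2 * C)%:E.
  rewrite variance_sum// ES EFinM; apply: leeD.
    by apply: lee_sum => k _; exact: variance_le_expectation.
  by rewrite lee_pmul2l.
(* Write x = m - M for the mean m, and K = 2 M + 4 |C|. Chebyshev will give x^2 <= 2 x + 2 M + 4 C
   <= 2 x + K, whereas x > 2 + K would force x^2 > 2 x + K x >= 2 x + 2 K. Hence m <= M + 2 + K. *)
exists (M + 2 + (2 * M + 4 * `|C|))%R => n.
rewrite -ES -(fineK (ESfin n)) lee_fin.
set m := fine _.
have [mM|Mm] := leP m M.
  by rewrite (le_trans mM)// -addrA lerDl addr_ge0// addr_ge0// mulr_ge0.
(* On the event of [PM], [S n] is at distance at least [m - M] from its mean [m], so
   Chebyshev's inequality yields [(m - M)^2 / 2 <= m + 2 C], which bounds [m]. *)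
have e0 : (0 < m - M)%R by rewrite subr_gt0.
have mf : S n \in mfun by rewrite inE; exact: mS.
have := @chebyshev _ _ _ P (mfun_Sub mf) _ e0.
have : (2^-1)%:E <= P [set w | (m - M <= `|S n w - m|)%R].
  rewrite (le_trans PM)// le_measure ?inE//.
  - by apply: bigcapT_measurable => k; rewrite -[X in measurable X]setTI; exact: measurable_fun_ler.
  - rewrite -[X in measurable X]setTI; apply: measurable_fun_ler => //.
    by apply: measurableT_comp => //; exact: measurable_funB.
  move=> w /(_ n Logic.I)/= SM; rewrite distrC.
  by rewrite (le_trans _ (ler_norm _))// lerD2l lerN2.
move=> h1 /(le_trans h1) /le_trans h2.
have : (2^-1)%:E <= ((m - M) ^- 2 * (m + 2 * C))%:E.
  apply: h2; rewrite EFinM lee_pmul2l// ?lte_fin ?invr_gt0 ?exprn_gt0//.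
  by rewrite (le_trans (VS n))// -(fineK (ESfin n)).
rewrite lee_fin mulrC ler_pdivlMr ?exprn_gt0// => h3.
have := ler_norm C; have := normr_ge0 C.
set x := (m - M)%R in e0 h3; have -> : m = (x + M)%R by rewrite /x subrK.
rewrite (_ : m = x + M)%R in h3; last by rewrite /x subrK.
move: (`|C|)%R => c c0 Cc.
rewrite leNgt; apply/negP => big.
have x2 : (2 + (2 * M + 4 * c) < x)%R by lra.
have := ltr_pM2r e0 (2 + (2 * M + 4 * c))%R x; rewrite x2 => x2x.
have : (0 <= (2 * M + 4 * c) * (x - 2))%R by apply: mulr_ge0; lra.
rewrite expr2 in h3; clearbody x; lra.
Qed.

End probability.

(** * Pathwise consequences of the strong law *)

Lemma powR_nat_ge (R : realType) (p A : R) : 0 < p ->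
  \forall n \near \oo, A <= n%:R `^ p^-1.
Proof.
move=> p0; near=> n.
rewrite (le_trans (ler_norm A))//.
have -> : `|A| = (`|A| `^ p) `^ p^-1.
  by rewrite -powRrM mulfV ?powRr1// gt_eqF.
rewrite ge0_ler_powR ?nnegrE ?invr_ge0 ?powR_ge0 ?(ltW p0)//.
by near: n; exact: nbhs_infty_ger.
Unshelve. all: by end_near. Qed.

(** The term [x n - c] is a difference of consecutive partial sums, which are eventually at most an
    eighth of their normalizers. By monotonicity of [a] each is at most [a n / 8], and so eventually
    is [c] in absolute value; the total 3/8 is below 1/2. *)
Lemma near_le_normalizer (R : realType) (x a : nat -> R) (c : R) :
  {homo a : m n / (m <= n)%N >-> m <= n} ->
  (forall A, \forall n \near \oo, A <= a n) ->
  (fun n => (a n)^-1 * \sum_(1 <= k < n.+1) (x k - c)) @ \oo --> 0 ->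
  \forall n \near \oo, `|x n| <= a n / 2.
Proof.
move=> amono aoo /cvgr0Pnorm_le/(_ 8^-1); rewrite invr_gt0 ltr0n => /(_ isT) h.
have [N1 _ H1] := h; have [N2 _ H2] := aoo 1; have [N3 _ H3] := aoo (8 * `|c|).
(* The successor ensures that the bounds hold at the preceding index as well. *)
exists (maxn N1 (maxn N2 N3)).+1 => // -[//|n] /=; rewrite ltnS !geq_max => /and3P[n1 n2 n3].
have sle m : (N1 <= m)%N -> (N2 <= m)%N ->
    `|\sum_(1 <= k < m.+1) (x k - c)| <= a m / 8.
  move=> m1 m2; have := H1 _ m1; rewrite /= normrM normfV.
  have am0 : 0 < a m by rewrite (lt_le_trans ltr01)// H2.
  rewrite (ger0_norm (ltW am0)) mulrC ler_pdivrMr// => /le_trans; apply.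
  by rewrite mulrC.
have := sle n n1 n2; have := sle n.+1 (leqW n1) (leqW n2).
rewrite big_nat_recr//=; set S := \sum_(_ <= _ < _) _.
have aa : a n <= a n.+1 by exact: amono.
have c8 : 8 * `|c| <= a n.+1 by apply: H3 => /=; exact: leqW.
move: c8; rewrite !ler_norml; move: (ler_norm c) (ler_normr c c) (ler_norm (- c)).
by rewrite normrN => c1 _ c2 c8 /andP[h1 h2] /andP[h3 h4]; apply/andP; split; lra.
Qed.

Lemma bounded_partial_sums_eventually0 (R : realType) (y : nat -> R) :
  (forall k, y k <= 1) -> (\forall n \near \oo, y n = 0) ->
  exists M, forall n, \sum_(1 <= k < n) y k <= M.
Proof.
move=> y1 [N _ y0]; exists N%:R => n.
(* Strengthened for the induction: below [N] each term costs at most 1, and from [N] on nothing is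
   added. *)
suff : \sum_(1 <= k < n) y k <= (minn n N)%:R.
  by move=> /le_trans; apply; rewrite ler_nat geq_minr.
elim: n => [|n IH]; first by rewrite big_geq.
have [->|n0] := posnP n; first by rewrite big_geq.
rewrite big_nat_recr//=; have [Nn|nN] := leqP N n.
  rewrite y0// addr0 (le_trans IH)// ler_nat leq_min geq_minr andbT.
  exact: leq_trans (geq_minl _ _) _.
rewrite (minn_idPl nN) -natr1 lerD// (le_trans IH)// ler_nat geq_minl//.
Qed.

(** * Application to both tails and conclusion *)

Theorem theorem1 (R : realType) (d : measure_display) (T : measurableType d)
  (P : probability T R) (p : R) (X : nat -> {RV P >-> R}) :
  1 <= p -> p < 2 ->
  identically_distributed X ->
  pairwise_PQD P (fun k => (X k : T -> R)) ->
  (exists c : R,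
     {ae P, forall w, (fun n : nat =>
        (n%:R `^ p^-1)^-1 * \sum_(1 <= k < n.+1) (X k w - c)) @ \oo --> 0}) ->
  (\sum_(1 <= k <oo) \sum_(k.+1 <= j <oo)
     ((k * j)%:R `^ (- p^-1))%:E%R
       * Gfun P (X k) (X j) (k%:R `^ p^-1) (j%:R `^ p^-1) < +oo)%E ->
  (\sum_(1 <= k <oo) P [set w | (k%:R `^ p^-1 < `|X 1%N w|)%R] < +oo)%E.
Proof.
move=> p1 _ idX pqdX [c aeX] Gfin.
have p0 : 0 < p by exact: lt_le_trans p1.
pose a (k : nat) : R := k%:R `^ p^-1.
have a0 k : 0 <= a k by exact: powR_ge0.
have agt0 k : (1 <= k)%N -> 0 < a k by move=> k1; rewrite powR_gt0// ltr0n.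
have H0 k j : (1 <= k)%N -> (k < j)%N -> forall x y, 0 <= Hcov P (X k) (X j) x y.
  move=> k1 kj x y; apply: Hcov_ge0 => //; apply: pqdX => //.
    exact: leq_trans (ltnW kj).
  by move=> kj'; move: kj; rewrite kj' ltnn.
have [C HC] : exists C : R, forall n,
    (\sum_(1 <= k < n) \sum_(k.+1 <= j < n)
       ((a k / 2)^-1 * (a j / 2)^-1)%:E * Gfun P (X k) (X j) (a k) (a j) <= C%:E)%E.
  move: Gfin; set g := fun k j : nat => (((k * j)%:R `^ (- p^-1))%:E *
    Gfun P (X k) (X j) (k%:R `^ p^-1) (j%:R `^ p^-1))%E => Gfin.
  have g0 k j : (1 <= k)%N -> (k < j)%N -> (0 <= g k j)%E.
    move=> k1 kj; rewrite mule_ge0 ?lee_fin ?powR_ge0//.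
    by apply: integral_ge0 => y _; apply: integral_ge0 => x _; rewrite lee_fin H0.
  have g0' k : (1 <= k)%N -> (0 <= \sum_(k.+1 <= j <oo) g k j)%E.
    by move=> k1; apply: nneseries_ge0 => j kj _; exact: g0.
  have Gf : (\sum_(1 <= k <oo) \sum_(k.+1 <= j <oo) g k j)%E \is a fin_num.
    by rewrite ge0_fin_numE// nneseries_ge0// => k k1 _; exact: g0'.
  (* Both ramps have half the threshold as width, so each normalization contributes a factor 2. *)
  exists (4 * fine (\sum_(1 <= k <oo) \sum_(k.+1 <= j <oo) g k j)%E) => n.
  rewrite EFinM fineK//.
  apply: (@le_trans _ _ (4%:E * \sum_(1 <= k < n) \sum_(k.+1 <= j < n) g k j)%E).
    rewrite big_nat [in leRHS]big_nat ge0_sume_distrr; last first.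
      move=> k /andP[k1 _]; rewrite big_nat; apply: sume_ge0 => j /andP[kj _].
      exact: g0.
    apply: lee_sum => k /andP[k1 _].
    rewrite big_nat [in leRHS]big_nat ge0_sume_distrr; last first.
      by move=> j /andP[kj _]; exact: g0.
    apply: lee_sum => j _; rewrite /g muleA -EFinM !invf_div.
    rewrite powRN natrM powRM// invfM -/(a k) -/(a j).
    rewrite (_ : 2 / a k * (2 / a j) = 4 * ((a k)^-1 / a j))//; ring.
  rewrite lee_pmul2l//.
  (* All terms being nonnegative, the finite triangle is dominated by the iterated series, first in
     [k] and then in [j]. *)
  apply: (le_trans _ (nneseries_lim_ge n _)); last by move=> k k1 _; exact: g0'.
  rewrite big_nat [leRHS]big_nat; apply: lee_sum => k /andP[k1 _].
  by apply: nneseries_lim_ge => j kj _; exact: g0.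
have aeXa : {ae P, forall w, \forall n \near \oo, `|X n w| <= a n / 2}.
  apply: filterS aeX => w; apply: near_le_normalizer.
    move=> m n mn; rewrite ge0_ler_powR ?nnegrE ?invr_ge0 ?(ltW p0)//.
    by rewrite ler_nat.
  by move=> A; exact: powR_nat_ge.
(* Common treatment of both tails: the ramp of width [a k / 2] starting at [s k] must stay within
   [[- a k, a k]], the range of [Gfun]. Only the covariances of [Y] are tied to the ramps, so [Y]
   may be a ramp or its complement. *)
have tail (s : nat -> R) (Y : nat -> T -> R) : (forall k, - a k <= s k) ->
   (forall k, s k + a k / 2 <= a k) ->
   (forall k, measurable_fun setT (Y k)) -> (forall k w, 0 <= Y k w <= 1) ->
   (forall k j, covariance P (Y k) (Y j) =
      covariance P (nramp (s k) (s k + a k / 2) \o X k)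
       (nramp (s j) (s j + a j / 2) \o X j)) ->
   (forall k w, (1 <= k)%N -> `|X k w| <= a k / 2 -> Y k w = 0) ->
   exists M : R, forall n, (\sum_(1 <= k < n) 'E_P[Y k] <= M%:E)%E.
  move=> s1 s2 mY Y01 covY Y0.
  apply: (expectation_partial_sums_bounded _ _ C) => // [n|].
    apply: le_trans (HC n).
    rewrite big_nat [leRHS]big_nat; apply: lee_sum => k /andP[k1 _].
    rewrite big_nat [leRHS]big_nat; apply: lee_sum => j /andP[kj _].
    have ad i : s i + a i / 2 - s i = a i / 2 by rewrite addrAC subrr add0r.
    have sd i : s i <= s i + a i / 2 by rewrite lerDl divr_ge0.
    rewrite covY -[in leRHS](ad k) -[in leRHS](ad j).
    by apply: covariance_nramp_le => //; exact: H0.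
  apply: filterS aeXa => w Xw; apply: bounded_partial_sums_eventually0.
    by move=> k; have /andP[] := Y01 k w.
  near=> n; apply: Y0; last by near: n.
  by near: n; exact: nbhs_infty_ge.
pose Y1 k : T -> R := nramp (a k / 2) (a k / 2 + a k / 2) \o X k.
pose Y2 k : T -> R := nramp (- a k) (- a k + a k / 2) \o X k.
have mY1 k : measurable_fun setT (Y1 k).
  by apply: measurableT_comp => //; exact: measurable_nramp.
have mY2 k : measurable_fun setT (Y2 k).
  by apply: measurableT_comp => //; exact: measurable_nramp.
have Y101 k w : 0 <= Y1 k w <= 1 by apply: nramp01; rewrite lerDl divr_ge0.
have Y201 k w : 0 <= Y2 k w <= 1 by apply: nramp01; rewrite lerDl divr_ge0.
(* Complementing the lower ramp turns it into a bump on the lower tail while keeping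
   all covariances. *)
pose Z k : T -> R := cst 1 \- Y2 k.
have mZ k : measurable_fun setT (Z k) by exact: measurable_funB.
have Z01 k w : 0 <= Z k w <= 1.
  by have /andP[y0 y1] := Y201 k w; rewrite subr_ge0 y1 gerBl.
have [M1 HM1] : exists M : R, forall n, (\sum_(1 <= k < n) 'E_P[Y1 k] <= M%:E)%E.
  apply: (tail (fun k => a k / 2)) => //.
  - by move=> k; rewrite (@le_trans _ _ 0)// ?oppr_le0 ?divr_ge0.
  - by move=> k; rewrite -splitr.
  move=> k w k1 Xk; apply: nramp0; first by rewrite lerDl divr_ge0.
  exact: le_trans (ler_norm _) Xk.
have [M2 HM2] : exists M : R, forall n, (\sum_(1 <= k < n) 'E_P[Z k] <= M%:E)%E.
  apply: (tail (fun k => - a k)) => //.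
  - by move=> k; have := a0 k; lra.
  - by move=> k j; rewrite covariance_onem//; exact: bounded01_Lfun2.
  move=> k w k1; have ak := agt0 k k1.
  rewrite ler_norml => /andP[Xk _]; rewrite /Z/= /Y2/= nramp1 ?subrr//.
    by rewrite ltrDl divr_gt0.
  by move: Xk; lra.
have PE k : (1 <= k)%N ->
    (P [set w | (a k < `|X 1%N w|)%R] <= 'E_P[Y1 k] + 'E_P[Z k])%E.
  move=> k1.
  pose A := [set x : R | a k < `|x|].
  have mA : measurable A.
    by rewrite -[A]setTI; apply: measurable_fun_ltr => //; exact: measurable_normr.
  (* Identical distribution replaces [X 1] by [X k], whose tail event can be compared pointwise with
     the bumps at level [k]. *)
  have := idX 1%N k isT k1 A mA; rewrite /distribution/pushforward => ->.
  have L1 (W : T -> R) : measurable_fun setT W -> (forall w, 0 <= W w <= 1) ->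
      W \in Lfun P 1.
    by move=> mW W01; apply/Lfun2_Lfun1/bounded01_Lfun2.
  rewrite -expectationD ?L1// -expectation_indic; last first.
    by rewrite -[X in measurable X]setTI; exact: measurable_funP.
  apply: expectation_le.
  - by apply: measurable_indic; rewrite -[X in measurable X]setTI; exact: measurable_funP.
  - exact: measurable_funD.
  - by move=> w.
  - move=> w; have /andP[y0 _] := Y101 k w; have /andP[z0 _] := Z01 k w.
    exact: addr_ge0.
  apply: aeW => w; have /andP[y0 _] := Y101 k w; have /andP[z0 _] := Z01 k w.
  rewrite indicE; case: (boolP (w \in _)) => [|_]; last exact: addr_ge0.
  rewrite inE /A/= => akX; have ak := agt0 k k1.
  (* Above [a k] the bump [Y1 k] equals 1; below [- a k] the bump [Z k] does. The other one is
     nonnegative. *)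
  move: akX; rewrite lter_normr => /orP[akX|akX].
    rewrite -[leLHS]addr0 lerD// /Y1/= nramp1//; first by rewrite ltrDl divr_gt0.
    by rewrite -splitr ltW.
  rewrite -[leLHS]add0r lerD// /Z/= /Y2/= nramp0 ?subr0//.
    by rewrite lerDl divr_ge0.
  by move: akX; lra.
apply: (@le_lt_trans _ _ (M1 + M2)%:E); last exact: ltry.
apply: lime_le; first by apply: is_cvg_nneseries.
apply: nearW => n; rewrite EFinD (le_trans _ (leeD (HM1 n) (HM2 n)))//.
rewrite -big_split/= big_nat [leRHS]big_nat; apply: lee_sum => k /andP[k1 _].
exact: PE.
Unshelve. all: by end_near. Qed.
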